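(* Every model $M$ of $T$ arises from a cycle-free graph $\Gamma$ by the following construction: replace every vertex $x\in\Gamma$ by a copy $F_x$ of the Farey graph, and for every edge $(x,y)$ of $\Gamma$ choose vertices $v_x\in F_x$, $v_y\in F_y$ and identify them.
   Context: Graphs are simple undirected graphs in the language $\{E\}$; subgraphs are induced. A vertex $x$ of a graph $A$ is removable from $A$ if it has at most one neighbour in $A$, or exactly two neighbours in $A$ which are adjacent. $T$ is the theory of graphs stating: (1) every edge is contained in exactly two triangles; (2) every finite subgraph has a removable vertex. The Farey graph $G_F$: $F_1$ is a single black edge contained in two triangles whose other sides are blue; $F_{n+1}$ is obtained from $F_n$ by adding, for every blue edge $e$ of $F_n$, a new vertex joined precisely to the endpoints of $e$ by two blue edges, and colouring all edges of $F_n$ black; $G_F=\bigcup_n F_n$ with colours forgotten.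
   Formalization: The formal theorem additionally assumes that M has no isolated vertex: the one-point graph satisfies both axioms of T, but no graph produced by the construction has an isolated vertex, so the claim fails without this. *)

(* Defs.v *)
From Stdlib Require Import Relation_Operators.
From mathcomp Require Import all_boot.
From mathcomp Require Import boolp classical_sets functions cardinality.

Set Implicit Arguments.
Unset Strict Implicit.
Unset Printing Implicit Defensive.

Local Open Scope classical_set_scope.
Local Open Scope card_scope.

(* Structures in the language {E}. *)
Record structure := Structure {
  carrier :> Type;
  adj : carrier -> carrier -> Prop }.

Arguments adj {s} x y : rename.

Definition simple_graph (G : structure) : Prop :=
  (forall x y : G, adj x y -> adj y x) /\ (forall x : G, ~ adj x x).

Definition isomorphic (G H : structure) : Prop :=
  exists f : G -> H, bijective f /\ forall x y : G, adj x y <-> adj (f x) (f y).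

Definition cycle_free (G : structure) : Prop :=
  forall (n : nat) (c : 'I_n -> G), 2 < n -> injective c ->
    ~ (forall i : 'I_n, adj (c i) (c (ordS i))).

Definition neighbours_in (G : structure) (A : set G) (x : G) : set G :=
  [set y | A y /\ adj x y].

Definition removable (G : structure) (A : set G) (x : G) : Prop :=
  A x /\
  (is_subset1 (neighbours_in A x) \/
   exists y z : G,
     [/\ y <> z, neighbours_in A x = [set y; z] & adj y z]).

Definition triangle (G : structure) (x y z : G) : Prop :=
  [/\ adj x y, adj y z & adj x z].

(* In a simple graph the triangles containing a given edge correspond to their
   third vertices. Induced subgraphs are given by their vertex sets, and the
   empty one is excluded, as it has no vertices at all. *)
Definition model_T (M : structure) : Prop :=
  [/\ simple_graph M,
      forall x y : M, adj x y -> [set z | triangle x y z] #= `I_2 &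
      forall A : set M, finite_set A -> A !=set0 ->
        exists x : M, removable A x].

(* A finite graph on the vertices 0, ..., nverts - 1 whose edges are coloured
   black or blue; each undirected edge is listed once, in some orientation. *)
Record stage := Stage {
  nverts : nat;
  black : seq (nat * nat);
  blue : seq (nat * nat) }.

Definition first_stage : stage :=
  Stage 4 [:: (0, 1)] [:: (0, 2); (2, 1); (1, 3); (3, 0)].

(* The new vertex attached to the i-th blue edge is nverts s + i. *)
Definition next_stage (s : stage) : stage :=
  Stage (nverts s + size (blue s))
        (black s ++ blue s)
        (flatten (mkseq (fun i =>
           let e := nth (0, 0) (blue s) i in
           let w := nverts s + i in [:: (e.1, w); (w, e.2)])
         (size (blue s)))).

(* Stages are numbered from 0: [farey_stage n] is F_{n+1}. *)
Definition farey_stage (n : nat) : stage := iter n next_stage first_stage.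

Definition stage_edge (s : stage) (x y : nat) : bool :=
  ((x, y) \in black s ++ blue s) || ((y, x) \in black s ++ blue s).

(* The union of the stages; its vertex set is all of nat by
   [farey_stage_vertices]. *)
Definition farey_graph : structure :=
  Structure (fun x y : nat => exists n : nat, stage_edge (farey_stage n) x y).

Lemma size_blue_gt0 n : 0 < size (blue (farey_stage n)).
Proof.
elim: n => [//|n IH]; rewrite /farey_stage iterS -/(farey_stage n) /=.
by case: (size _) IH.
Qed.

Lemma farey_stage_vertices (x : nat) : exists n, x < nverts (farey_stage n).
Proof.
exists x; elim: x => [//|x IH].
rewrite /farey_stage iterS -/(farey_stage x) /=.
by rewrite -[x.+2]addn1 leq_add // size_blue_gt0.
Qed.

Definition wf_stage (s : stage) :=
  all (fun e => [&& e.1 < nverts s, e.2 < nverts s & e.1 != e.2])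
      (black s ++ blue s).

Lemma wf_farey_stage n : wf_stage (farey_stage n).
Proof.
elim: n => [//|n]; rewrite /farey_stage iterS -/(farey_stage n).
move: (farey_stage n) => s wf; rewrite /wf_stage /= all_cat; apply/andP; split.
  apply: sub_all wf => e /and3P[h1 h2 h3].
  by rewrite !(leq_trans _ (leq_addr _ _)).
apply/allP => e /flattenP[l /mapP[i]]; rewrite mem_iota add0n => /andP[_ ilt] ->.
have := allP wf (nth (0, 0) (blue s) i); rewrite mem_cat mem_nth // orbT.
move=> /(_ isT) /and3P[h1 h2 _].
by rewrite !inE => /orP[] /eqP -> /=; rewrite ltn_add2l ilt /=
   ?(leq_trans h1 (leq_addr _ _)) ?(leq_trans h2 (leq_addr _ _)) //=;
   [rewrite ltn_eqF // | rewrite gtn_eqF //]; apply: leq_trans (leq_addr _ _).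
Qed.

Lemma farey_graph_simple : simple_graph farey_graph.
Proof.
split=> [x y [n xy]|x [n]]; first by exists n; rewrite /stage_edge orbC.
rewrite /stage_edge orbb => /(allP (wf_farey_stage n)).
by rewrite eqxx !andbF.
Qed.

(* The pair (x, u) is the vertex u of the copy F_x. For an edge (x, y) of Gamma,
   [v x y] is the vertex chosen in F_x and [v y x] the one chosen in F_y; the
   values of v at non-adjacent pairs are not used. *)
Definition glue_step (Gamma : structure) (v : Gamma -> Gamma -> farey_graph)
    (p q : Gamma * farey_graph) : Prop :=
  exists x y : Gamma, [/\ adj x y, p = (x, v x y) & q = (y, v y x)].

Definition glue_class (Gamma : structure) (v : Gamma -> Gamma -> farey_graph)
    (p : Gamma * farey_graph) : set (Gamma * farey_graph) :=
  [set q | clos_refl_sym_trans _ (glue_step v) p q].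

(* The quotient of the disjoint union of the copies F_x by the equivalence
   relation generated by [glue_step], its points being the classes. *)
Definition glue (Gamma : structure) (v : Gamma -> Gamma -> farey_graph) :
    structure :=
  @Structure {C : set (Gamma * farey_graph) | exists p, C = glue_class v p}
    (fun C D => exists (x : Gamma) (u w : farey_graph),
       [/\ sval C (x, u), sval D (x, w) & adj u w]).

Arguments glue : clear implicits.

Definition no_isolated_vertex (G : structure) : Prop :=
  forall x : G, exists y : G, adj x y.

(* The axioms in [model_T] alone admit isolated vertices, whereas a glued graph
   has none; hence [no_isolated_vertex] has to be required separately. *)
Lemma point_model_T : model_T (@Structure unit (fun _ _ => False)).
Proof.
split; [by split=> [? ? []|? []] | by move=> x y [] | ].
move=> A _ [x Ax]; exists x; split=> //; left.
by move=> y z [_ []].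
Qed.

Lemma farey_no_isolated : no_isolated_vertex farey_graph.
Proof.
move=> x; have [n] := farey_stage_vertices x; elim: n => [|n IH].
  by case: x => [|[|[|[|//]]]] _; [exists 1|exists 0|exists 0|exists 0]; exists 0.
have [/IH //|xge] := ltnP x (nverts (farey_stage n)).
rewrite /farey_stage iterS -/(farey_stage n) /= => xlt.
set i := x - nverts (farey_stage n).
have ilt : i < size (blue (farey_stage n)) by rewrite ltn_subLR.
exists (nth (0, 0) (blue (farey_stage n)) i).2; exists n.+1.
rewrite /stage_edge /farey_stage iterS -/(farey_stage n) /=.
apply/orP; left; rewrite mem_cat; apply/orP; right; apply/flattenP.
eexists; first by apply: map_f; rewrite mem_iota /= add0n; exact: ilt.
by rewrite !inE subnKC // eqxx orbT.
Qed.

Lemma glue_no_isolated (Gamma : structure) (v : Gamma -> Gamma -> farey_graph) :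
  no_isolated_vertex (glue Gamma v).
Proof.
case=> C [[x u] CE]; have [w uw] := farey_no_isolated u.
exists (exist _ (glue_class v (x, w)) (ex_intro _ (x, w) erefl)).
by exists x, u, w; split=> //=; rewrite ?CE; apply: rst_refl.
Qed.

(* Main.v *)
From Stdlib Require Import Relation_Operators.
From mathcomp Require Import all_boot zify.
From mathcomp Require Import boolp classical_sets functions cardinality.
Require Import Defs.

(** Removing removable vertices one at a time shows that [n >= 2] vertices of a
    model of [T] span at most [2 n - 3] edges. A triangulated polygon has exactly
    that many, so when the Farey graph is developed in [M] from any edge, no
    unexpected edge can ever appear, and the development is an isomorphism onto
    an induced subgraph closed under triangles. These subgraphs, the components,
    partition the edges of [M].

    A cycle of length at least 4 has a vertex whose two neighbours are adjacent,
    so by induction on the length every cycle of [M] lies in one component.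
    Hence a walk avoiding the edges of a component [K] cannot join two distinct
    vertices of [K]: components meet in at most one vertex, and their incidences
    contain no cycle. [Gamma] has the components as vertices; the components
    through a vertex [m] of [M] are joined in a star, so that they get identified
    at [m] without creating cycles. *)

Set Implicit Arguments.
Unset Strict Implicit.
Unset Printing Implicit Defensive.

Local Open Scope classical_set_scope.
Local Open Scope card_scope.

(** * The Farey graph on the natural numbers *)

(* Listing the blue edges in the order of their creation linearises the
   construction: for [i < 4] edge [i] is a blue edge of the first stage, vertex
   [4 + i] is the one attached to edge [i], and the two blue edges it creates
   are edges [4 + i.*2] and [5 + i.*2]. The triple at [i] consists of the two
   ends [fl i] and [fr i] of edge [i] and the apex [ft i] of the older of the
   two triangles on it. *)
Fixpoint farey_tri_rec (k i : nat) : nat * nat * nat :=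
  if i < 4 then nth (0, 0, 0) [:: (0, 2, 1); (2, 1, 0); (1, 3, 0); (3, 0, 1)] i
  else if k is k'.+1 then
    let j := (i - 4)./2 in
    let: (a, b, _) := farey_tri_rec k' j in
    if odd i then (4 + j, b, a) else (a, 4 + j, b)
  else (0, 0, 0).

Definition farey_tri i := farey_tri_rec i i.
Definition fl i := (farey_tri i).1.1.
Definition fr i := (farey_tri i).1.2.
Definition ft i := (farey_tri i).2.

(** The recursion passes from [i] to the smaller [(i - 4)./2], so fuel [i] suffices. *)
Lemma farey_tri_rec_fuel k l i : i <= k -> i <= l ->
  farey_tri_rec k i = farey_tri_rec l i.
Proof.
elim: k l i => [|k IH] [|l] i //=; first by case: i.
- by case: i.
- by move=> ik il; case: ifP => // i4; rewrite (IH l) //; lia.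
Qed.

Lemma farey_tri_step i : 4 <= i -> farey_tri i =
  let j := (i - 4)./2 in
  if odd i then (4 + j, fr j, fl j) else (fl j, 4 + j, fr j).
Proof.
case: i => // i i4; rewrite /farey_tri [LHS]/= [i.+1 < 4]ltnNge i4 /=.
rewrite (@farey_tri_rec_fuel _ (i.+1 - 4)./2) //; last by lia.
by rewrite /fl /fr /farey_tri; case: (farey_tri_rec _ _) => [[a b] c].
Qed.

Lemma farey_tri_even i : farey_tri (4 + i.*2) = (fl i, 4 + i, fr i).
Proof. by rewrite farey_tri_step //= oddD odd_double addKn doubleK. Qed.

Lemma farey_tri_odd i : farey_tri (5 + i.*2) = (4 + i, fr i, fl i).
Proof.
rewrite farey_tri_step // oddD odd_double.
by have -> : (5 + i.*2 - 4)./2 = i by lia.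
Qed.

Lemma fl_even i : fl (4 + i.*2) = fl i. Proof. by rewrite /fl farey_tri_even. Qed.
Lemma fr_even i : fr (4 + i.*2) = 4 + i. Proof. by rewrite /fr farey_tri_even. Qed.
Lemma ft_even i : ft (4 + i.*2) = fr i. Proof. by rewrite /ft farey_tri_even. Qed.
Lemma fl_odd i : fl (5 + i.*2) = 4 + i. Proof. by rewrite /fl farey_tri_odd. Qed.
Lemma fr_odd i : fr (5 + i.*2) = fr i. Proof. by rewrite /fr farey_tri_odd. Qed.
Lemma ft_odd i : ft (5 + i.*2) = fl i. Proof. by rewrite /ft farey_tri_odd. Qed.

Definition farey_triE := (fl_even, fr_even, ft_even, fl_odd, fr_odd, ft_odd).

(** Every [i >= 4] is a child of [(i - 4)./2]: this is induction along the forest of blue edges. *)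
Lemma farey_index_ind (P : nat -> Prop) :
  (forall i, i < 4 -> P i) -> (forall i, P i -> P (4 + i.*2)) ->
  (forall i, P i -> P (5 + i.*2)) -> forall i, P i.
Proof.
move=> P4 Pe Po; elim/ltn_ind => i IH.
have [/P4 //|i4] := ltnP i 4.
have Pj : P (i - 4)./2 by apply: IH; lia.
have [oi|ei] := boolP (odd i).
  by move: (Po _ Pj); rewrite (_ : 5 + _ = i) //; lia.
by move: (Pe _ Pj); rewrite (_ : 4 + _ = i) //; lia.
Qed.

Lemma ltn4P i : i < 4 -> [\/ i = 0, i = 1, i = 2 | i = 3].
Proof.
by case: i => [|[|[|[|]]]] // _;
  [constructor 1 | constructor 2 | constructor 3 | constructor 4].
Qed.

Lemma farey_base_lt i : i < 4 -> fl i < 4 /\ fr i < 4.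
Proof. by case/ltn4P => ->. Qed.

Lemma farey_tri_lt i : [/\ fl i < 4 + i, fr i < 4 + i & ft i < 4 + i].
Proof.
elim/farey_index_ind: i => [i /ltn4P[]->|i [? ? ?]|i [? ? ?]] //.
- by rewrite !farey_triE; split; lia.
- by rewrite !farey_triE; split; lia.
Qed.

Lemma fl_neq_fr i : fl i <> fr i.
Proof.
elim/farey_index_ind: i => [i /ltn4P[]->|i ?|i ?] //.
- by have [? ? ?] := farey_tri_lt i; rewrite !farey_triE; lia.
- by have [? ? ?] := farey_tri_lt i; rewrite !farey_triE; lia.
Qed.

(** The edge from [0] to [1] is black from the start and so has no index. *)
Definition farey_edge x y := (x = 0 /\ y = 1) \/ exists i, x = fl i /\ y = fr i.
Definition farey_adj x y := farey_edge x y \/ farey_edge y x.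

Lemma farey_adjC x y : farey_adj x y -> farey_adj y x.
Proof. by case; [right|left]. Qed.

Lemma farey_adj_lr i : farey_adj (fl i) (fr i).
Proof. by left; right; exists i. Qed.

Lemma farey_adj01 : farey_adj 0 1.
Proof. by left; left. Qed.

(** An edge of index [j >= 4] has newer end [4 + (j - 4)./2], so [4 + i] is the newer end of the
    edges [4 + i.*2] and [5 + i.*2] only. *)
Lemma farey_adj_newP i x : x < 4 + i ->
  farey_adj x (4 + i) <-> x = fl i \/ x = fr i.
Proof.
move=> xi; split; last first.
  case=> ->.
    by have := farey_adj_lr (4 + i.*2); rewrite !farey_triE.
  by have := farey_adj_lr (5 + i.*2); rewrite !farey_triE => /farey_adjC.
case=> -[[]|[j []]]; try lia; elim/farey_index_ind: j => [j j4|j _|j _].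
- by have := farey_base_lt j4; lia.
- by have [? ? ?] := farey_tri_lt j; rewrite !farey_triE => -> ?; left; congr fl; lia.
- have [? ? ?] := farey_tri_lt j; rewrite !farey_triE; lia.
- by have := farey_base_lt j4; lia.
- have [? ? ?] := farey_tri_lt j; rewrite !farey_triE; lia.
- by have [? ? ?] := farey_tri_lt j; rewrite !farey_triE => ? ->; right; congr fr; lia.
Qed.

Lemma farey_adj_left i : farey_adj (fl i) (4 + i).
Proof. by have [? ? ?] := farey_tri_lt i; apply/farey_adj_newP => //; left. Qed.

Lemma farey_adj_right i : farey_adj (fr i) (4 + i).
Proof. by have [? ? ?] := farey_tri_lt i; apply/farey_adj_newP => //; right. Qed.

Lemma farey_irr x : ~ farey_adj x x.
Proof.
case=> -[[]|[j []]]; try lia; by have := @fl_neq_fr j; lia.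
Qed.

Lemma farey_adj_base :
  [/\ farey_adj 0 1, farey_adj 0 2, farey_adj 1 2, farey_adj 0 3 & farey_adj 1 3].
Proof.
split; first exact: farey_adj01.
- exact: (farey_adj_lr 0).
- exact: farey_adjC (farey_adj_lr 1).
- exact: farey_adjC (farey_adj_lr 3).
- exact: (farey_adj_lr 2).
Qed.

Lemma farey_nadj23 : ~ farey_adj 2 3.
Proof.
case=> -[[]|[j []]]; try lia; elim/farey_index_ind: j => [j j4|j _|j _];
  rewrite ?farey_triE; try lia; by case/ltn4P: j4 => ->.
Qed.

Lemma farey_adj_apex i : farey_adj (fl i) (ft i) /\ farey_adj (fr i) (ft i).
Proof.
elim/farey_index_ind: i => [i i4|i [? ?]|i [? ?]].
- have [? ? ? ? ?] := farey_adj_base.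
  by case/ltn4P: i4 => ->; split=> //; apply: farey_adjC.
- rewrite !farey_triE; split; first exact: farey_adj_lr.
  exact/farey_adjC/farey_adj_right.
- rewrite !farey_triE; split; first exact/farey_adjC/farey_adj_left.
  exact/farey_adjC/farey_adj_lr.
Qed.

(** From index 4 on, the newer end of an edge determines its parent, and the older end tells the
    left child from the right one. *)
Lemma farey_edge_inj i j : (fl i = fl j /\ fr i = fr j) \/
  (fl i = fr j /\ fr i = fl j) -> i = j.
Proof.
elim/farey_index_ind: i => [i i4|i _|i _];
elim/farey_index_ind: j => [j j4|j _|j _]; rewrite ?farey_triE.
- by case/ltn4P: i4 => ->; case/ltn4P: j4 => -> //=; rewrite /fl /fr /=; lia.
- by have := farey_base_lt i4; lia.
- by have := farey_base_lt i4; lia.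
- by have := farey_base_lt j4; lia.
- by have [? ? ?] := farey_tri_lt i; have [? ? ?] := farey_tri_lt j; lia.
- have [? ? ?] := farey_tri_lt i; have [? ? ?] := farey_tri_lt j.
  case; first lia.
  by case=> eq1 /addnI ij; move: eq1 (@fl_neq_fr j); rewrite ij; lia.
- by have := farey_base_lt j4; lia.
- have [? ? ?] := farey_tri_lt i; have [? ? ?] := farey_tri_lt j.
  case; first lia.
  by case=> /addnI ij eq1; move: eq1 (@fl_neq_fr j); rewrite ij; lia.
- by have [? ? ?] := farey_tri_lt i; have [? ? ?] := farey_tri_lt j; lia.
Qed.

(* Edge [i] is still on the boundary of the triangulated polygon spanned by the
   first [4 + m] vertices when [m <= i < 4 + m.*2]. *)
Lemma farey_boundary_apex m i z : m <= i < 4 + m.*2 -> z < 4 + m ->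
  farey_adj z (fl i) -> farey_adj z (fr i) -> z = ft i.
Proof.
elim: m => [|m IH] in i z * => /andP[mi im] zm zl zr.
  have n23 := farey_nadj23; have n32 : ~ farey_adj 3 2 by move/farey_adjC.
  have irr := @farey_irr.
  by move: zl zr {mi}; case/ltn4P: im => ->; case/ltn4P: zm => -> //= zl zr;
    first [case: (irr _ zl) | case: (irr _ zr) | case: (n23 zl) |
           case: (n32 zl) | case: (n23 zr) | case: (n32 zr)].
(* If [i >= 4 + m.*2], edge [i] ends at the newest vertex [4 + m], whose older neighbours are the
   two ends of edge [m]. *)
have [im'|im'] := ltnP i (4 + m.*2); last first.
  have [? ? ?] := farey_tri_lt m.
  have [i4|i5] : i = 4 + m.*2 \/ i = 5 + m.*2 by lia.
    move: zl zr; rewrite i4 !farey_triE => zl zr.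
    have zm' : z < 4 + m.
      by rewrite ltn_neqAle -ltnS zm andbT; apply/eqP => zE;
        case: (@farey_irr z); rewrite {2}zE.
    case: (farey_adj_newP zm') => /(_ zr) [] // zE.
    by case: (@farey_irr z); rewrite {2}zE.
  move: zl zr; rewrite i5 !farey_triE => zl zr.
  have zm' : z < 4 + m.
    by rewrite ltn_neqAle -ltnS zm andbT; apply/eqP => zE;
        case: (@farey_irr z); rewrite {2}zE.
  case: (farey_adj_newP zm') => /(_ zl) [] // zE.
  by case: (@farey_irr z); rewrite {2}zE.
have [zm'|zm'] := ltnP z (4 + m); first by apply: IH => //; lia.
(* If the newest vertex saw both ends of the older edge [i], these would be the ends of edge [m];
   but then [i = m], which has left the boundary. *)
have zE : z = 4 + m by lia.
have lm : fl i < 4 + m.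
  rewrite ltnNge; apply/negP => h.
  elim/farey_index_ind: i => [i i4|i _|i _] in mi im im' zl zr h *;
    have [? ? ?] := farey_tri_lt i; rewrite ?farey_triE in h; try lia.
  by have := farey_base_lt i4; lia.
have rm : fr i < 4 + m.
  rewrite ltnNge; apply/negP => h.
  elim/farey_index_ind: i => [i i4|i _|i _] in lm mi im im' zl zr h *;
    have [? ? ?] := farey_tri_lt i; rewrite ?farey_triE in h; try lia.
  by have := farey_base_lt i4; lia.
rewrite zE in zl zr.
have [/(_ (farey_adjC zl)) lE _] := farey_adj_newP lm.
have [/(_ (farey_adjC zr)) rE _] := farey_adj_newP rm.
have := @fl_neq_fr i; have := @farey_edge_inj i m; lia.
Qed.

(** * Agreement with the stages of the definition *)

Lemma flatten_pairs (T : Type) (h : nat -> T) k n :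
  flatten [seq [:: h j.*2; h j.*2.+1] | j <- iota k n] =
  [seq h i | i <- iota k.*2 n.*2].
Proof. by elim: n k => //= n IH k; rewrite IH doubleS. Qed.

Definition flr i := (fl i, fr i).

(** A step attaches a vertex to each of the [k + 4] blue edges, turning [k] into [4 + k.*2]. The
    bound [n <= k] ensures that every index gets into some stage. *)
Lemma farey_stageE n : exists2 k, n <= k & farey_stage n =
  Stage (4 + k) ((0, 1) :: map flr (iota 0 k)) (map flr (iota k (k + 4))).
Proof.
elim: n => [|n [k nk sE]]; first by exists 0.
exists (4 + k.*2); first lia.
rewrite /farey_stage iterS -/(farey_stage n) sE /next_stage.
rewrite [blue _]/= [black _]/= [nverts _]/= size_map size_iota.
congr Stage; first lia.
  rewrite cat_cons -map_cat; congr (_ :: map _ _).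
  by rewrite -{2}[k]add0n -iotaD; congr iota; lia.
have -> : 4 + k.*2 + 4 = (k + 4).*2 by lia.
have -> : 4 + k.*2 = (2 + k).*2 by lia.
rewrite -(flatten_pairs flr) /mkseq; congr flatten.
rewrite -[2 + k]addn0 iotaDl -map_comp.
apply/eq_in_map => i; rewrite mem_iota => /andP[_ ik].
rewrite (nth_map 0) ?size_iota // nth_iota //= -!addnA.
have -> : (2 + (k + i)).*2 = 4 + (k + i).*2 by lia.
have -> : (4 + (k + i).*2).+1 = 5 + (k + i).*2 by lia.
by rewrite /flr !farey_triE.
Qed.

Lemma farey_graphP (x y : farey_graph) : adj x y <-> farey_adj x y.
Proof.
split=> [[n]|].
  have [k nk ->] := farey_stageE n.
  have H a b : (a, b) \in ((0, 1) :: map flr (iota 0 k)) ++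
      map flr (iota k (k + 4)) -> farey_edge a b.
    rewrite mem_cat inE -orbA -mem_cat -map_cat => /orP[/eqP[-> ->]|]; first by left.
    by case/mapP => i _ [-> ->]; right; exists i.
  by case/orP => /H; [left|right].
have H a b : farey_edge a b ->
    exists n, (a, b) \in black (farey_stage n) ++ blue (farey_stage n).
  case=> [[-> ->]|[i [-> ->]]]; first by exists 0.
  exists i.+1; have [k ik ->] /= := farey_stageE i.+1.
  rewrite inE; apply/orP; right; rewrite mem_cat; apply/orP; left.
  by apply/mapP; exists i => //; rewrite mem_iota; lia.
by case=> /H[n nE]; exists n; rewrite /stage_edge nE ?orbT.
Qed.

(** An edge and its parent share a triangle, so [P] descends from any edge to the edge from [0] to
    [1], and then spreads to all vertices in order of creation. *)
Lemma farey_triangle_connected (P : nat -> Prop) a b :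
  (forall x y z, farey_adj x y -> farey_adj y z -> farey_adj x z ->
     P x -> P y -> P z) ->
  farey_adj a b -> P a -> P b -> forall x, P x.
Proof.
move=> cl ab Pa Pb.
have [a01 a02 a12 a03 a13] := farey_adj_base.
have desc i : P (fl i) -> P (fr i) -> P 0 /\ P 1.
  elim/farey_index_ind: i => [i|i IH|i IH].
  - case/ltn4P => -> Pl Pr; split=> //.
    + by apply: (cl 0 2 1) => //; exact: farey_adjC.
    + by apply: (cl 2 1 0) => //; exact: farey_adjC.
    + by apply: (cl 1 3 0) => //; exact: farey_adjC.
    + by apply: (cl 3 0 1) => //; exact: farey_adjC.
  - rewrite !farey_triE => Pl Pn; apply: IH => //.
    apply: (cl (fl i) (4 + i)) => //; [exact: farey_adj_left| |exact: farey_adj_lr].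
    exact/farey_adjC/farey_adj_right.
  - rewrite !farey_triE => Pn Pr; apply: IH => //.
    apply: (cl (fr i) (4 + i)) => //; [exact: farey_adj_right| |].
      exact/farey_adjC/farey_adj_left.
    exact/farey_adjC/farey_adj_lr.
have [P0 P1] : P 0 /\ P 1.
  by case: ab => -[[aE bE]|[i [aE bE]]]; rewrite aE bE in Pa Pb; auto; apply: (desc i).
elim/ltn_ind => x IH.
have [/ltn4P[]->|x4] := ltnP x 4; [by []|by []|by apply: (cl 0 1)|by apply: (cl 0 1)|].
have xE : x = 4 + (x - 4) by lia.
have [? ? _] := farey_tri_lt (x - 4).
rewrite xE; apply: (cl (fl (x - 4)) (fr (x - 4))).
- exact: farey_adj_lr.
- exact: farey_adj_right.
- exact: farey_adj_left.
- by apply: IH; lia.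
- by apply: IH; lia.
Qed.

Definition farey_rel : rel nat := fun x y => `[< farey_adj x y >].

Lemma farey_lower x : 0 < x -> exists2 y, y < x & farey_adj x y.
Proof.
have [x4|x4 _] := ltnP x 4.
  have [a01 a02 a12 a03 a13] := farey_adj_base.
  by case/ltn4P: x4 => -> // _; exists 0 => //; exact: farey_adjC.
have [? _ _] := farey_tri_lt (x - 4).
exists (fl (x - 4)); first lia.
have {1}-> : x = 4 + (x - 4) by lia.
exact/farey_adjC/farey_adj_left.
Qed.

Lemma farey_connected x y : exists2 s, path farey_rel x s & last x s = y.
Proof.
have to0 : exists2 s, path farey_rel x s & last x s = 0.
  elim/ltn_ind: x => x IH; case: (posnP x) => [->|/farey_lower[z zx xz]].
    by exists [::].
  by have [s ps ls] := IH z zx; exists (z :: s) => //=; rewrite ps andbT; exact: asboolT.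
have from0 : exists2 s, path farey_rel 0 s & last 0 s = y.
  elim/ltn_ind: y => y IH; case: (posnP y) => [->|/farey_lower[z zy yz]].
    by exists [::].
  have [s ps ls] := IH z zy; exists (rcons s y); last by rewrite last_rcons.
  by rewrite rcons_path ps ls /=; exact/asboolT/farey_adjC.
have [s ps ls] := to0; have [s' ps' ls'] := from0.
by exists (s ++ s'); rewrite ?cat_path ?last_cat ?ps ls.
Qed.

(** * Developing the Farey graph in a model *)

Lemma farey_rec (T : Type) (g : T -> T -> T -> T) a b c d : exists f : nat -> T,
  [/\ f 0 = a, f 1 = b, f 2 = c, f 3 = d &
      forall i, f (4 + i) = g (f (fl i)) (f (fr i)) (f (ft i))].
Proof.
(* [F n] has its final values below [4 + n], so the diagonal gives the limit. *)
pose F := fix F n := if n is n'.+1 then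
    fun x => if x == 4 + n' then g (F n' (fl n')) (F n' (fr n')) (F n' (ft n'))
             else F n' x
  else nth a [:: a; b; c; d].
have Fst n k x : x < 4 + n -> F (n + k) x = F n x.
  move=> xn; elim: k => [|k IH]; rewrite ?addn0 // addnS /=.
  by rewrite ifN ?IH //; lia.
exists (fun x => F x x).
split; [by []|by rewrite (Fst 0 1)|by rewrite (Fst 0 2)|by rewrite (Fst 0 3)|].
move=> i; have -> : F (4 + i) (4 + i) = F i.+1 (4 + i).
  by rewrite -(Fst i.+1 3 (4 + i)); [congr (F _ _)|]; lia.
have [? ? ?] := farey_tri_lt i.
have Fd x : x < 4 + i -> F i x = F x x.
  move=> xi; have [ix|ix] := leqP i x.
    by rewrite -(Fst i (x - i)) //; congr (F _ _); lia.
  by rewrite -(Fst x (i - x)); [congr (F _ _)|]; lia.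
by rewrite /= eqxx !Fd.
Qed.

(** The double sum counts every edge twice. Deleting a vertex with at most two neighbours lowers it
    by at most 4, and two vertices span at most one edge. *)
Lemma edge_bound (T : finType) (r : rel T) : symmetric r -> irreflexive r ->
  (forall A : {set T}, A != finset.set0 ->
    exists2 x, x \in A & #|[set y in A | r x y]%SET| <= 2) ->
  forall A : {set T}, 1 < #|A| ->
    \sum_(x in A) \sum_(y in A) r x y + 6 <= 4 * #|A|.
Proof.
move=> rsym rirr rem A; move: {2}#|A| (erefl #|A|) => n.
elim: n A => [|n IH] A An A1; first by rewrite An in A1.
have [|x xA] := rem A; first by rewrite -card_gt0; lia.
have cardB : #|A :\ x| = n by move: (cardsD1 x A); rewrite xA; lia.
have -> : #|[set y in A | r x y]%SET| = \sum_(y in A :\ x) r x y.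
  rewrite -sum1_card (eq_bigl (fun y => (y \in A) && r x y)); last first.
    by move=> y; rewrite inE.
  rewrite big_mkcondr (big_setD1 x xA) /= rirr add0n.
  by apply: eq_bigr => y _; case: (r x y).
have dB : \sum_(y in A :\ x) r x y <= n.
  by rewrite -cardB -sum1_card; apply: leq_sum => y _; exact: leq_b1.
rewrite (big_setD1 x xA) /= (big_setD1 x xA) /= rirr add0n.
have -> : \sum_(z in A :\ x) \sum_(y in A) r z y =
    \sum_(y in A :\ x) r x y + \sum_(z in A :\ x) \sum_(y in A :\ x) r z y.
  rewrite -big_split; apply: eq_bigr => z _.
  by rewrite (big_setD1 x xA) /= rsym.
have [n1|n1] := leqP n 1; last by have := IH _ cardB; rewrite cardB; lia.
have /cards1P[z ->] : #|A :\ x| == 1 by apply/eqP; lia.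
by rewrite !big_set1 rirr; have := leq_b1 (r x z); lia.
Qed.

Definition pairs_below (r : rel nat) n := \sum_(i < n) \sum_(j < n) r i j.

Lemma pairs_belowS (r : rel nat) n : symmetric r -> irreflexive r ->
  pairs_below r n.+1 = pairs_below r n + #|[set i : 'I_n | r i n]%SET| * 2.
Proof.
move=> rsym rirr; rewrite /pairs_below big_ord_recr /=.
under eq_bigr do rewrite big_ord_recr /=.
rewrite big_split big_ord_recr /= rirr addn0 -addnA; congr addn.
have -> : \sum_(i < n) r n i = \sum_(i < n) r i n.
  by apply: eq_bigr => i _; rewrite rsym.
rewrite addnn -muln2; congr muln.
rewrite -sum1dep_card [RHS]big_mkcond; apply: eq_bigr => i _.
by case: (r i n).
Qed.

(** * Edge bound and charts in a model *)

Section Model.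
Variables (M : structure) (hM : model_T M).

Lemma mT_sym (x y : M) : adj x y -> adj y x.
Proof. by case: hM => -[+ _] _ _; exact. Qed.

Lemma mT_irr (x : M) : ~ adj x x.
Proof. by case: hM => -[_ +] _ _; exact. Qed.

Lemma third_vertices (x y : M) : adj x y -> exists c d : M,
  c <> d /\ forall z, triangle x y z <-> z = c \/ z = d.
Proof.
case: hM => _ h2 _ /h2 /card_set_bijP[f [ffun finj fsurj]].
have [c [cT fc]] : ([set z | triangle x y z] `&` (f @^-1` [set 0])) !=set0.
  by have [c ? ?] := fsurj 0 isT; exists c.
have [d [dT fd]] : ([set z | triangle x y z] `&` (f @^-1` [set 1])) !=set0.
  by have [d ? ?] := fsurj 1 isT; exists d.
rewrite /= in cT fc dT fd.
exists c, d; split=> [cd|z]; first by rewrite cd fd in fc.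
split=> [zT|[]-> //].
have : f z < 2 by exact: ffun.
case E: (f z) => [|[|]] // _; [left|right]; apply: finj; rewrite ?inE //; congruence.
Qed.

Lemma removable_few (A : set M) x : removable A x ->
  exists y z, forall w, A w -> adj x w -> w = y \/ w = z.
Proof.
case=> Ax [H|[y [z [_ H _]]]].
  have [[y [Ay xy]]|N] := pselect (exists y, A y /\ adj x y).
    by exists y, y => w Aw xw; left; apply: H.
  by exists x, x => w Aw xw; case: N; exists w.
exists y, z => w Aw xw.
by have : neighbours_in A x w by []; rewrite H.
Qed.

(** Axiom (2), applied to the images of sets of indices, provides the vertices of degree at most two
    that [edge_bound] asks for. *)
Lemma embedded_edge_bound n (f : 'I_n -> M) : injective f -> 1 < n ->
  \sum_(i < n) \sum_(j < n) `[< adj (f i) (f j) >] + 6 <= 4 * n.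
Proof.
move=> finj n1.
have := @edge_bound _ (fun i j => `[< adj (f i) (f j) >]) _ _ _ [set: 'I_n]%SET.
rewrite cardsT card_ord n1.
under eq_bigl do rewrite finset.in_setT.
under eq_bigr do under eq_bigl do rewrite finset.in_setT.
apply => //.
- by move=> i j; apply/asboolP/asboolP => /mT_sym.
- by move=> i; apply/asboolP/mT_irr.
move=> A /set0Pn[i0 Ai0]; have [_ _ h3] := hM.
have [||_ [[i Ai <-] H]] := h3 (f @` [set` A]).
- exact/finite_image/finite_finset.
- by exists (f i0), i0.
exists i => //; have [y [z yz]] := removable_few (conj (ex_intro2 _ _ i Ai erefl) H).
rewrite leqNgt; apply/negP => /card_gt2P[a [b [c [[]]]]].
rewrite !inE => /andP[Aa /asboolP ia] /andP[Ab /asboolP ib] /andP[Ac /asboolP ic].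
case=> /eqP ab /eqP bc /eqP ca.
have im j : j \in A -> (f @` [set` A]) (f j) by exists j.
have := yz _ (im _ Aa) ia; have := yz _ (im _ Ab) ib; have := yz _ (im _ Ac) ic.
by case=> [c1|c1] [b1|b1] [a1|a1];
  first [case: ab; apply: finj; congruence | case: bc; apply: finj; congruence
        | case: ca; apply: finj; congruence].
Qed.

(** Axiom (1) as a function reflecting the apex of a triangle across an edge; it is the recursion
    step of the development. *)
Lemma other_vertex : exists g : M -> M -> M -> M,
  forall x y z, triangle x y z -> g x y z <> z /\ triangle x y (g x y z).
Proof.
have H (t : M * M * M) : exists w, triangle t.1.1 t.1.2 t.2 ->
    w <> t.2 /\ triangle t.1.1 t.1.2 w.
  case: t => [[x y] z] /=; have [[xy ? ?]|] := pselect (triangle x y z); last by exists x.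
  have [c [d [cd cdP]]] := third_vertices xy.
  have [cz|cz] := pselect (c = z).
    by exists d => _; rewrite -cz; split; [exact: nesym|apply/cdP; right].
  by exists c => _; split=> //; apply/cdP; left.
have [g gP] := choice H.
by exists (fun x y z => g (x, y, z)) => x y z; apply: (gP (x, y, z)).
Qed.

Lemma triangle_two (x y z z' w : M) : triangle x y z -> triangle x y z' ->
  z <> z' -> triangle x y w -> w = z \/ w = z'.
Proof.
move=> xyz; have [xy _ _] := xyz; have [c [d [cd cdP]]] := third_vertices xy.
move: xyz => /cdP + /cdP + + /cdP.
by case=> -> [] -> // _ []; auto.
Qed.

(* A chart is an isomorphism of the Farey graph onto an induced subgraph that
   contains every triangle having an edge in it. *)
Definition chart (f : nat -> M) : Prop :=
  [/\ injective f, forall x y, adj (f x) (f y) <-> farey_adj x y &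
      forall x y z, triangle (f x) (f y) z -> range f z].

(** The first [n] vertices attain the edge bound. The new vertex adds at least the two edges to [p]
    and [q], and the bound for [n.+1] vertices leaves room for no third one. *)
Lemma embedding_step (f : nat -> M) n p q :
  (forall x y, x < n.+1 -> y < n.+1 -> f x = f y -> x = y) ->
  pairs_below (fun x y => `[< adj (f x) (f y) >]) n + 6 = 4 * n ->
  p < n -> q < n -> p <> q -> adj (f p) (f n) -> adj (f q) (f n) ->
  (forall x, x < n -> adj (f x) (f n) <-> x = p \/ x = q) /\
  pairs_below (fun x y => `[< adj (f x) (f y) >]) n.+1 + 6 = 4 * n.+1.
Proof.
set r := fun x y => _; move=> finj En pn qn pq fp fq.
have rsym : symmetric r by move=> i j; apply/asboolP/asboolP => /mT_sym.
have rirr : irreflexive r by move=> i; apply/asboolP/mT_irr.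
have ES := pairs_belowS n rsym rirr.
have Ele : pairs_below r n.+1 + 6 <= 4 * n.+1.
  apply: (@embedded_edge_bound n.+1 (f \o val)); last lia.
  by move=> i j fij; apply: val_inj; apply: finj fij; exact: ltn_ord.
have le2 : #|[set i : 'I_n | r i n]%SET| <= 2 by lia.
have ge2 : 1 < #|[set i : 'I_n | r i n]%SET|.
  apply/card_gt1P; exists (Ordinal pn), (Ordinal qn); rewrite !inE.
  by split=> //; apply/eqP => -[].
split; last lia.
move=> x xn; split=> [fx|[]-> //].
have [->|/eqP xp] := eqVneq x p; first by left.
have [->|/eqP xq] := eqVneq x q; first by right.
move: le2; rewrite leqNgt => /negP[].
apply/card_gt2P; exists (Ordinal pn), (Ordinal qn), (Ordinal xn).
rewrite !inE; split; split=> //; apply/eqP => -[] //; exact: nesym.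
Qed.

Lemma chart_build (f : nat -> M) :
  triangle (f 0) (f 1) (f 2) -> triangle (f 0) (f 1) (f 3) -> f 2 <> f 3 ->
  (forall i, triangle (f (fl i)) (f (fr i)) (f (ft i)) ->
     f (4 + i) <> f (ft i) /\ triangle (f (fl i)) (f (fr i)) (f (4 + i))) ->
  chart f.
Proof.
move=> [a01 a12 a02] [_ a13 a03] f23 fS.
have irr := mT_irr.
have neq (x y : M) : adj x y -> x <> y by move=> xy E; rewrite E in xy; case: (irr y).
have [b01 b02 b12 b03 b13] := farey_adj_base.
have wlog_lt n : (forall x y, x < y -> y < n -> adj (f x) (f y) <-> farey_adj x y) ->
    forall x y, x < n -> y < n -> adj (f x) (f y) <-> farey_adj x y.
  move=> H x y xn yn; case: (ltngtP x y) => [xy|xy|->]; first exact: H.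
    have [H1 H2] := H _ _ xy xn.
    by split=> [/mT_sym/H1/farey_adjC|/farey_adjC/H2/mT_sym].
  by split=> [/mT_irr|/farey_irr].
(* The exact edge count belongs to the invariant so that [embedding_step] applies again. *)
have inv k : [/\ forall x y, x < 4 + k -> y < 4 + k -> f x = f y -> x = y,
    forall x y, x < 4 + k -> y < 4 + k -> adj (f x) (f y) <-> farey_adj x y
  & pairs_below (fun x y => `[< adj (f x) (f y) >]) (4 + k) + 6 = 4 * (4 + k)].
  elim: k => [|k [finj fadj En]].
    have inj x y : x < 4 -> y < 4 -> f x = f y -> x = y.
      move: (neq _ _ a01) (neq _ _ a02) (neq _ _ a12) => ? ? ?.
      move: (neq _ _ a03) (neq _ _ a13) => ? ?.
      by move=> /ltn4P[]-> /ltn4P[]-> // E; exfalso; congruence.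
    (* The count starts from the triangle on [0], [1], [2]. Adding vertex [3] by [embedding_step]
       also shows that [2] and [3] are not adjacent. *)
    have E3 : pairs_below (fun x y => `[< adj (f x) (f y) >]) 3 + 6 = 4 * 3.
      rewrite /pairs_below !big_ord_recr !big_ord0 /=.
      rewrite (asboolT a01) (asboolT a02) (asboolT a12) (asboolT (mT_sym a01)).
      rewrite (asboolT (mT_sym a02)) (asboolT (mT_sym a12)).
      by rewrite !(asboolF (@irr _)).
    have [H E] := @embedding_step f 3 0 1 inj E3 isT isT (@O_S 0) a03 a13.
    split=> //; apply: wlog_lt => x y xy /ltn4P[] yE; subst y => //.
    - by case: x xy.
    - by case: x xy => [|[|]].
    - split=> [/(H _ xy)[]-> //|h]; apply/(H _ xy).
      by case: x xy h => [|[|[|]]] // _; [left|right|move/farey_nadj23].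
  have [l4 r4 t4] := farey_tri_lt k.
  have [tl tr] := farey_adj_apex k.
  have lr := farey_adj_lr k.
  have [|fnt [_ rn ln]] := fS k; first by split; apply/fadj.
  (* An old vertex hit again would see both ends of the boundary edge [k], so it would be [ft k],
     whose image the new one avoids. *)
  have fnew z : z < 4 + k -> f z <> f (4 + k).
    move=> zk fz; apply: fnt; rewrite -fz; congr f.
    apply: (@farey_boundary_apex k) => //; first lia.
      by apply/fadj => //; rewrite fz; apply: mT_sym.
    by apply/fadj => //; rewrite fz; apply: mT_sym.
  have inj x y : x < 5 + k -> y < 5 + k -> f x = f y -> x = y.
    have [xk|xk] := ltnP x (4 + k); have [yk|yk] := ltnP y (4 + k) => xk' yk' fxy.
    - exact: finj.
    - by case: (fnew x xk); rewrite fxy; congr f; lia.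
    - by case: (fnew y yk); rewrite -fxy; congr f; lia.
    - lia.
  have [H E] := @embedding_step f (4 + k) (fl k) (fr k) inj En l4 r4 (@fl_neq_fr k) ln rn.
  split=> //; apply: wlog_lt => x y xy yk.
  have [yk'|yk'] := ltnP y (4 + k); first by apply: fadj => //; lia.
  have yE : y = 4 + k by lia.
  by rewrite yE in xy *; rewrite H // farey_adj_newP.
have finj : injective f.
  by move=> x y; have [H _ _] := inv (x + y); apply: H; lia.
have fadj x y : adj (f x) (f y) <-> farey_adj x y.
  by have [_ H _] := inv (x + y); apply: H; lia.
split=> // x y z.
have swap u v w : triangle (f u) (f v) w -> triangle (f v) (f u) w.
  by case=> h1 h2 h3; split=> //; apply: mT_sym.
(* The image already has two triangles on each edge: with apices [2] and [3] on the first edge,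
   [ft i] and [4 + i] on edge [i]. Axiom (1) allows no other. *)
have cl u v : farey_edge u v -> triangle (f u) (f v) z -> range f z.
  case=> [[-> ->]|[i [-> ->]]] tz.
    by case: (@triangle_two _ _ (f 2) (f 3) _ _ _ _ tz) => // ->; [exists 2|exists 3].
  have [tl tr] := farey_adj_apex i.
  have [|fnt tn] := fS i; first by split; apply/fadj => //; exact: farey_adj_lr.
  case: (@triangle_two _ _ (f (ft i)) (f (4 + i)) _ _ _ _ tz) => //.
  - by split; apply/fadj => //; exact: farey_adj_lr.
  - exact: nesym.
  - by move=> ->; exists (ft i).
  - by move=> ->; exists (4 + i).
move=> t; have [/fadj [] xy _ _] := t; first exact: cl xy t.
exact: cl xy (swap _ _ _ t).
Qed.

Lemma chart_exists (a b : M) : adj a b -> exists2 f, chart f & f 0 = a /\ f 1 = b.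
Proof.
move=> ab; have [c [d [cd cdP]]] := third_vertices ab.
have [g gP] := other_vertex.
have [f [f0 f1 f2 f3 fS]] := farey_rec g a b c d.
exists f => //; apply: chart_build.
- by rewrite f0 f1 f2; apply/cdP; left.
- by rewrite f0 f1 f3; apply/cdP; right.
- by rewrite f2 f3.
- by move=> i /gP; rewrite fS.
Qed.

End Model.

(** * Components and cycles *)

Section Components.
Variables (M : structure) (hM : model_T M).
(** Classical equality on vertices, for [uniq] and membership in sequences. *)
Local Notation T := {classic (carrier M)}.

Definition component (K : set M) : Prop := exists2 f, chart f & K = range f.

Lemma component_edge (a b : M) : adj a b -> exists2 K, component K & K a /\ K b.
Proof.
move=> /(chart_exists hM)[f fc [fa fb]]; exists (range f); first by exists f.
by split; [exists 0|exists 1].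
Qed.

Lemma component_triangle K x y z :
  component K -> K x -> K y -> triangle x y z -> K z.
Proof. by move=> [f [_ _ fcl] ->] [i _ <-] [j _ <-] /fcl. Qed.

(** The preimage of [K'] under a chart of [K] is closed under completing triangles and contains an
    edge, so it is everything. *)
Lemma component_sub K K' (x y : M) : component K -> component K' ->
  adj x y -> K x -> K y -> K' x -> K' y -> K `<=` K'.
Proof.
move=> [f [finj fadj fcl] ->] K'c xy [i _ fi] [j _ fj] K'x K'y _ [k _ <-].
rewrite -fi -fj in xy K'x K'y.
apply: (@farey_triangle_connected (fun k => K' (f k)) i j) => //; last exact/fadj.
move=> a b c /fadj ab /fadj bc /fadj ac K'a K'b.
exact: component_triangle K'c K'a K'b _.
Qed.

Lemma component_eq K K' (x y : M) : component K -> component K' ->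
  adj x y -> K x -> K y -> K' x -> K' y -> K = K'.
Proof.
by move=> *; apply/seteqP; split; apply: component_sub; eassumption.
Qed.

Definition radj : rel T := fun x y => `[< @adj M x y >].

Lemma component_connected K (u v : T) : component K -> K u -> K v ->
  exists s : seq T, [/\ path radj u s, last u s = v & {in s, forall w, K w}].
Proof.
move=> [f [finj fadj fcl] ->] [i _ <-] [j _ <-].
have [s ps ls] := farey_connected i j.
exists (map f s : seq T); split.
- elim: s i {ls} ps => //= k s IH i /andP[/asboolP ik /IH ->].
  by rewrite andbT; exact/asboolT/fadj.
- by rewrite last_map ls.
- by move=> w /mapP[k _ ->]; exists k.
Qed.

(* Cutting off a removable vertex of a cycle of length at least 4 leaves a
   shorter cycle, because its two neighbours are adjacent. *)
Lemma cycle_in_component (c : seq T) : 2 < size c -> uniq c -> cycle radj c ->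
  exists2 K, component K & {in c, forall x, K x}.
Proof.
move: {2}(size c) (erefl (size c)) => n; elim: n c => [|n IH] c; first by move=> ->.
move=> cn c2 cu cc.
have [_ _ /(_ [set x : M | (x : T) \in c])[]] := hM.
- exact: (@finite_seq T).
- by case: c c2 {cn cu cc} => // x c _; exists x; rewrite /= mem_head.
move=> x [xc xrem]; rewrite /= in xc.
(* With [x] rotated to the front, its neighbours along the cycle are the second vertex [y] and the
   last vertex [z]. *)
have [i c' cE] := rot_to xc.
have memc : c =i ((x : T) :: c' : seq T) by move=> y; rewrite -cE mem_rot.
move: cc cu cn c2; rewrite -(rot_cycle i) -(rot_uniq i) -(size_rot i) cE.
case: c' cE memc => // y c'; case/lastP: c' => // c' z cE memc.
move=> cc cu cn c2.
move: (cc); rewrite /= rcons_path last_rcons => /and3P[/asboolP xy pyz /asboolP zx].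
have yz : y <> z.
  by move=> yzE; move: cu; rewrite /= yzE mem_rcons mem_head !andbF.
have Ay : neighbours_in [set x : M | (x : T) \in c] x y.
  by split=> //=; rewrite memc !inE eqxx orbT.
have Az : neighbours_in [set x : M | (x : T) \in c] x z.
  by split; [rewrite /= memc !inE mem_rcons mem_head !orbT|exact: (mT_sym hM)].
have ayz : @adj M y z.
  case: xrem => [H|[y' [z' [_ H y'z']]]]; first by case: yz; exact: H.
  move: Ay Az; rewrite H => -[yE|yE] [zE|zE].
  - by case: yz; rewrite yE zE.
  - by rewrite yE zE.
  - by rewrite yE zE; exact: (mT_sym hM).
  - by case: yz; rewrite yE zE.
(* A cycle of length 3 is a triangle, which lies in the component of any of its edges. *)
have [n3|n3] := leqP n 2.
  have c'0 : c' = [::].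
    by apply/nilP; rewrite /nilp; move: cn; rewrite /= size_rcons => -[]; lia.
  have [K Kc [Kx Ky]] := component_edge xy; exists K => // w.
  rewrite memc c'0 !inE => /or3P[] /eqP-> //.
  by apply: component_triangle Kc Kx Ky _; split=> //; exact: (mT_sym hM).
have [||||K Kc KP] := IH (y :: rcons c' z).
- by case: cn.
- by move: cn => /= -[->].
- by case/andP: cu.
- by rewrite /= rcons_path pyz last_rcons; exact/asboolT/(mT_sym hM).
exists K => // w; rewrite memc inE => /predU1P[->|/KP //].
apply: (component_triangle Kc _ _ (_ : triangle y z x)).
- by apply: KP; rewrite mem_head.
- by apply: KP; rewrite inE mem_rcons mem_head orbT.
- by split=> //; exact: (mT_sym hM).
Qed.

(** A component is an induced subgraph, so these are the edges of [M] that do not belong to [K]. *)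
Definition outside (K : set M) : rel T :=
  fun x y => `[< @adj M x y /\ ~ (K x /\ K y) >].

Lemma outside_radj K : subrel (outside K) radj.
Proof. by move=> x y /asboolP[? _]; exact/asboolT. Qed.

(** Otherwise a path back from [z] to [u] inside [K] closes the detour to a cycle. The component
    containing it shares an edge with [K], hence equals [K], but also contains interior vertices of
    the detour. *)
Lemma detour_trivial K (u z : T) (s : seq T) : component K -> K u -> K z ->
  {in s, forall w, ~ K w} -> path (outside K) u (rcons s z) -> u = z.
Proof.
move=> Kc Ku Kz; case: s => [_|w s sK] /=.
  by rewrite andbT => /asboolP[_ []].
move=> /andP[/asboolP[uw _]]; rewrite rcons_path.
move=> /andP[/(sub_path (@outside_radj K)) ps /outside_radj sz].
have [//|uz] := eqVneq u z.
have [q [pq lq qK]] := component_connected Kc Kz Ku.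
have wK : ~ K w by apply: sK; rewrite mem_head.
(* Once both pieces are shortened the cycle has no repetition, one piece being disjoint from [K] and
   the other inside it. *)
case/shortenP: ps sz => s' ps' us' ss' sz.
case/shortenP: pq lq => q' pq' uq' sq' lq.
have q'K : {in z :: q', forall x, K x}.
  by move=> x /predU1P[->//|/sq'/qK].
case: q' => [|y q'] in pq' uq' lq q'K {sq'}.
  by move: uz; rewrite -lq eqxx.
have [|||K' K'c K'P] := @cycle_in_component ((w :: s') ++ z :: y :: q').
- by rewrite size_cat /=; lia.
- rewrite cat_uniq us' uq' andbT andTb.
  apply/hasPn => x /q'K Kx; apply/negP => xs; apply: (sK x) => //.
  by move: xs; rewrite !inE => /orP[->//|/ss' ->]; rewrite orbT.
- rewrite /= rcons_cat cat_path ps' [rcons _ _]/= [path _ _ _]/= sz /=.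
  move: pq' => /= /andP[-> pq']; rewrite rcons_path pq' /=.
  by move: lq => /= ->; exact/asboolT.
have zy : @adj M z y by case/andP: pq' => /asboolP.
have KK' : K = K'.
  apply: (component_eq Kc K'c zy) => //.
  - by apply: q'K; rewrite !inE eqxx orbT.
  - by apply: K'P; rewrite mem_cat mem_head orbT.
  - by apply: K'P; rewrite mem_cat !inE eqxx !orbT.
by case: wK; rewrite KK'; apply: K'P; rewrite mem_cat mem_head.
Qed.

(** Cut at the first return to [K]: the initial piece is a detour, so it returns to [u], and the
    rest is shorter. *)
Lemma outside_walk K (u v : T) s : component K -> K u -> K v ->
  path (outside K) u s -> last u s = v -> u = v.
Proof.
move=> Kc; move: {2}(size s) (leqnn (size s)) => n.
elim: n u s => [|n IH] u s; first by case: s.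
case: s => [//|w s'] sn Ku Kv ps ls.
have hK : has (fun x : T => `[< K x >]) (w :: s').
  apply/hasP; exists v; last exact/asboolT.
  by rewrite -ls /= mem_last.
move: ps ls sn; case/split_find: hK => z s1 s2 /asboolP Kz s1K.
rewrite cat_path last_cat !last_rcons size_cat size_rcons => /andP[p1 p2] ls sn.
have <- : z = v by apply: IH ls => //; lia.
apply: (detour_trivial Kc Ku Kz _ p1).
move=> x xs1 Kx; move/hasPn: s1K => /(_ x xs1) /negP; apply.
exact/asboolT.
Qed.

(** Distinct components share no edge, so a path inside [K'] serves. *)
Lemma component_outside K K' (u v : T) : component K -> component K' ->
  K <> K' -> K' u -> K' v ->
  exists2 s, path (outside K) u s & last u s = v.
Proof.
move=> Kc K'c KK' K'u K'v.
have [s [ps ls sK]] := component_connected K'c K'u K'v.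
exists s => //; elim: s u {ls} K'u ps sK => //= w s IH u K'u /andP[/asboolP uw ps] sK.
have K'w : K' w by apply: sK; rewrite mem_head.
rewrite IH // ?andbT.
  apply/asboolT; split=> // -[Ku Kw].
  exact/KK'/(component_eq Kc K'c uw).
by move=> x xs; apply: sK; rewrite inE xs orbT.
Qed.

Lemma component_meet K K' (u v : M) : component K -> component K' ->
  K <> K' -> K u -> K' u -> K v -> K' v -> u = v.
Proof.
move=> Kc K'c KK' Ku K'u Kv K'v.
have [s ps ls] := component_outside Kc K'c KK' K'u K'v.
exact: (outside_walk Kc Ku Kv ps ls).
Qed.

End Components.

(** * Gluing *)

Section Gluing.
Variables (M : structure) (hM : model_T M).
Local Notation comp := {K : set M | component K}.
Variables (centre : M -> comp) (centreP : forall m, sval (centre m) m).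

(* Joining all pairs of components through [m] would create triangles, hence
   the star around [centre m]. *)
Definition star_graph : structure := @Structure comp (fun K K' =>
  exists m : M, [/\ K <> K', sval K m, sval K' m &
                    K = centre m \/ K' = centre m]).

Lemma star_graph_simple : simple_graph star_graph.
Proof.
split=> [K K' [m [KK' Km K'm cm]]|K [m []//]].
by exists m; split=> //; [exact: nesym|case: cm; auto].
Qed.

Lemma comp_neq (K K' : comp) : K <> K' -> sval K <> sval K'.
Proof. by case: K K' => K Kc [K' K'c] KK' /= E; apply: KK'; exact: eq_exist. Qed.

Lemma comp_meet (K K' : comp) u v : K <> K' ->
  sval K u -> sval K' u -> sval K v -> sval K' v -> u = v.
Proof. by move=> /comp_neq; exact: component_meet (svalP K) (svalP K'). Qed.

(** Going round a cycle the long way gives a walk outside [C i.+1] between its two gluing points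
    [m i] and [m i.+1], so all gluing points coincide; but a star contains no cycle. *)
Lemma star_graph_cycle_free : cycle_free star_graph.
Proof.
move=> n c n2 cinj cadj.
have n0 : 0 < n by lia.
pose o k : 'I_n := Ordinal (ltn_pmod k n0).
(* Indices are read modulo [n], so that one can walk past the end of the cycle. *)
have oS k : ordS (o k) = o k.+1.
  by apply: val_inj; rewrite /= -addn1 modnDml addn1.
have [m' m'P] := choice cadj.
pose C k := c (o k); pose m k := m' (o k).
have mP k : [/\ C k <> C k.+1, sval (C k) (m k), sval (C k.+1) (m k) &
    C k = centre (m k) \/ C k.+1 = centre (m k)].
  by have := m'P (o k); rewrite oS.
have Cinj j k : C j = C k -> j = k %[mod n] by move=> /cinj [].
have mn k : m (k + n) = m k.
  by congr m'; apply: val_inj; rewrite /= modnDr.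
have chain i k : k < n -> exists2 s, path (outside (sval (C i))) (m i) s &
    last (m i) s = m (i + k).
  elim: k => [|k IH] kn; first by exists [::]; rewrite ?addn0.
  have [|s ps ls] := IH; first lia.
  have [_ _ mk _] := mP (i + k); have [_ mk1 _ _] := mP (i + k).+1.
  have neq : C i <> C (i + k).+1.
    move/Cinj => /eqP; rewrite -{1}[i]addn0 -addnS eqn_modDl.
    by rewrite !modn_small //; lia.
  have [s' ps' ls'] := component_outside (svalP (C i)) (svalP (C (i + k).+1))
    (comp_neq neq) mk mk1.
  by exists (s ++ s'); rewrite ?cat_path ?last_cat ?ps ls // addnS.
have mS i : m i.+1 = m i.
  have [|s ps ls] := chain i.+1 n.-1; first lia.
  have E : i.+1 + n.-1 = i + n by lia.
  have [_ mi1 _ _] := mP i.+1; have [_ _ + _] := mP i; rewrite -(mn i) -E => mi.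
  exact: (outside_walk hM (svalP (C i.+1)) mi1 mi ps ls).
(* Three consecutive edges would each contain the same centre, although [C 0], [C 2] differ and so
   do [C 1], [C 3], because [n > 2]. *)
have m1 := mS 0; have m2 : m 2 = m 0 by rewrite mS.
have [c01 _ _ C01] := mP 0; have [c12 _ _] := mP 1; have [c23 _ _] := mP 2.
rewrite m1 m2 => C23 C12.
have c13 : C 1 <> C 3.
  move/Cinj => /eqP; rewrite -[1]addn0 -[3]/(1 + 2) eqn_modDl.
  by rewrite mod0n modn_small; lia.
have c02 : C 0 <> C 2.
  by move/Cinj => /eqP; rewrite mod0n modn_small; lia.
case: C01 => E0; case: C12 => E1; case: C23 => E2; congruence.
Qed.

(** * The isomorphism with the glued graph *)

Variable ch : comp -> nat -> M.
Hypothesis chP : forall K, chart (ch K) /\ sval K = range (ch K).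

Lemma ch_inj K : injective (ch K).
Proof. by have [[]] := chP K. Qed.

Lemma ch_adj K i j : adj (ch K i) (ch K j) <-> @adj farey_graph i j.
Proof. by have [[_ H _] _] := chP K; rewrite H farey_graphP. Qed.

Lemma ch_mem K i : sval K (ch K i).
Proof. by have [_ ->] := chP K; exists i. Qed.

Lemma ch_surj (K : comp) m : sval K m -> exists i, ch K i = m.
Proof. by have [_ ->] := chP K => -[i _ <-]; exists i. Qed.

(** The position in [K] of its common vertex with [K']; [0] is a default for components that do not
    meet. *)
Definition star_vertex (K K' : star_graph) : farey_graph :=
  xget 0 [set i | sval K' (ch K i)].

Lemma star_vertexP (K K' : star_graph) i : K <> K' -> sval K' (ch K i) ->
  star_vertex K K' = i.
Proof.
move=> KK' Ki; rewrite /star_vertex; case: xgetP => [j _ Kj|/(_ i)//].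
by apply: (@ch_inj K); apply: (comp_meet KK') => //; exact: ch_mem.
Qed.

Definition point (p : star_graph * farey_graph) : M := ch p.1 p.2.

Lemma glue_step_point p q : glue_step star_vertex p q -> point p = point q.
Proof.
move=> [K [K' [[m [KK' Km K'm _]] -> ->]]]; rewrite /point /=.
have [i im] := ch_surj Km; have [j jm] := ch_surj K'm.
by rewrite (@star_vertexP K K' i) ?(@star_vertexP K' K j) ?im ?jm //; exact: nesym.
Qed.

(** Gluing steps preserve [point]. Conversely, any pair over [m] is equal to, or one step away from,
    the pair over [m] in the copy of [centre m]. *)
Lemma glue_classP p q : glue_class star_vertex p q <-> point p = point q.
Proof.
split.
  by rewrite /glue_class /=; elim=> [x y /glue_step_point|x|x y _ ->|x y z _ -> _ ->].
have to_centre r : exists2 i, ch (centre (point r)) i = point r &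
    clos_refl_sym_trans _ (glue_step star_vertex) r (centre (point r), i).
  case: r => K k; set m := point _.
  have [i im] := ch_surj (centreP m); exists i => //.
  have Km : sval K m by exact: ch_mem.
  have [KE|KE] := pselect (K = centre m).
    suff -> : (K, k) = (centre m, i) by apply: rst_refl.
    by congr pair => //; apply: (@ch_inj K); rewrite {2}KE im.
  apply: rst_step; exists K, (centre m); split.
  - by exists m; split=> //; right.
  - by congr pair; rewrite (@star_vertexP _ _ k) // -/m.
  - by congr pair; rewrite (@star_vertexP _ _ i) ?im //; exact: nesym.
move=> pq; have [i im pi] := to_centre p; have [j jm qj] := to_centre q.
apply: rst_trans pi _; apply: rst_sym; move: qj; rewrite -pq in jm *.
by have -> : i = j by apply: (@ch_inj (centre (point p))); rewrite im jm.
Qed.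

Lemma glue_isomorphic : isomorphic M (glue star_graph star_vertex).
Proof.
have /choice[h hP] (m : M) : exists p : star_graph * farey_graph, point p = m.
  by have [i im] := ch_surj (centreP m); exists (centre m, i).
pose f (m : M) : glue star_graph star_vertex :=
  exist _ (glue_class star_vertex (h m)) (ex_intro _ (h m) erefl).
(* The vertices of the glued graph are thus the fibres of [point]. *)
have fP m q : sval (f m) q <-> point q = m.
  by rewrite /= glue_classP hP; split=> ->.
have /choice[g gP] (C : glue star_graph star_vertex) :
    exists p, sval C = glue_class star_vertex p.
  exact: svalP C.
exists f; split.
  exists (point \o g) => [m|C] /=.
    have := gP (f m); move/seteqP => -[_ /(_ (g (f m)))].
    by move=> /(_ (rst_refl _ _ _)) /fP.
  have fgC : sval (f (point (g C))) = sval C.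
    rewrite (gP C); apply/seteqP; split=> q; first by move/fP/esym/glue_classP.
    by move/glue_classP/esym/fP.
  by case: C fgC => C ?; exact: eq_exist.
move=> x y; split=> [xy|[K [u [w [/fP <- /fP <- uw]]]]]; last exact/ch_adj.
have [K Kc [Kx Ky]] := component_edge hM xy.
have [i ix] := @ch_surj (exist _ K Kc) _ Kx.
have [j jy] := @ch_surj (exist _ K Kc) _ Ky.
exists (exist _ K Kc), i, j; split; [exact/fP|exact/fP|].
by apply/(@ch_adj (exist _ K Kc)); rewrite ix jy.
Qed.

End Gluing.

Theorem theorem2p23 (M : structure) (hM : model_T M)
    (hiso : no_isolated_vertex M) :
  exists (Gamma : structure) (v : Gamma -> Gamma -> farey_graph),
    simple_graph Gamma /\ cycle_free Gamma /\ isomorphic M (glue Gamma v).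
Proof.
(* A vertex lies in the component of any edge at it, and [hiso] supplies such an edge. *)
have /choice[centre centreP] (m : M) :
    exists K : {K : set M | component K}, sval K m.
  have [y my] := hiso m; have [K Kc [Km _]] := component_edge hM my.
  by exists (exist _ K Kc).
have /choice[ch chP] (K : {K : set M | component K}) :
    exists f, chart f /\ sval K = range f.
  by case: K => K /= [f fc ->]; exists f.
exists (star_graph centre), (@star_vertex _ centre ch); split; [|split].
- exact: star_graph_simple.
- exact: star_graph_cycle_free.
- exact: glue_isomorphic.
Qed.
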